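(* (Progress, live variables.) Let $P$ be a program, let $(\beta_{\bullet l},\beta_{l\bullet})_{l}$ be the live variables analysis result for $P$, let $\rightarrow$ be the standard execution relation of $P$ and $\Rightarrow$ the live-variables augmented execution relation of $P$. For all labels $l,l'$ and states $\sigma,\sigma'$: if $\langle l,\sigma\rangle\rightarrow\langle l',\sigma'\rangle$, then $\langle l,\sigma,\beta_{\bullet l}\rangle\Rightarrow\langle l',\sigma',\beta_{\bullet l'}\rangle$.
   Context: Language. $N$ is the set of integers, $T=\{\mathbf{true},\mathbf{false}\}$, $V$ a set of variables, $L$ a set of labels. Arithmetic expressions $E$: $e::=n\mid v\mid e_0+e_1\mid e_0-e_1\mid e_0\times e_1$ ($n\in N$, $v\in V$). Boolean expressions $B$: $b::=\mathbf{true}\mid\mathbf{false}\mid e_0=e_1\mid e_0\le e_1\mid\mathbf{not}\,b\mid b_0\,\mathbf{and}\,b_1\mid b_0\,\mathbf{or}\,b_1$. Commands: $c::=\mathbf{skip}\mid v:=e\mid\mathbf{if}\,b\,\mathbf{then}\,g\mid\mathbf{goto}\,g\mid\mathbf{halt}\mid\mathbf{done}$ ($g\in L$). $\mathbf{vars}(e)$, $\mathbf{vars}(b)$ are the sets of variables occurring in $e$, $b$. A program $P$ is a sequence of labeled commands $l:c$ with pairwise distinct labels; $\mathbf{next}(l)$ is the label of the command following $l$ in the sequence. If $l:\mathbf{halt}\in P$ then $\mathbf{next}(l):\mathbf{done}\in P$. Branch targets $g$, and $\mathbf{next}(l)$ for each assignment, $\mathbf{skip}$, $\mathbf{if}$ or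 $\mathbf{halt}$ command at $l$, are labels of $P$. Successors: $\mathbf{succ}(l)=\{\mathbf{next}(l)\}$ for assignment, $\mathbf{skip}$, $\mathbf{halt}$; $\{g\}$ for $\mathbf{goto}\,g$; $\{\mathbf{next}(l),g\}$ for $\mathbf{if}\,b\,\mathbf{then}\,g$; $\emptyset$ for $\mathbf{done}$. Standard semantics. A state is a partial function $\sigma:V\rightharpoonup N$ with domain $\mathrm{dom}\,\sigma$. The evaluation relations $\langle e,\sigma\rangle\rightarrow n$ and $\langle b,\sigma\rangle\rightarrow t$ are the least relations with: constants evaluate to themselves; $\langle v,\sigma\rangle\rightarrow\sigma(v)$ if $v\in\mathrm{dom}\,\sigma$; a compound expression evaluates to the result of applying its operator to the values of all of its immediate subexpressions, provided all of these evaluate (no short-circuiting). The relation $\langle l,\sigma\rangle\rightarrow\langle l',\sigma'\rangle$ is the least relation with: if $l:v:=e\in P$ and $\langle e,\sigma\rangle\rightarrow n$, then $\langle l,\sigma\rangle\rightarrow\langle\mathbf{next}(l),\sigma[v\mapsto n]\rangle$; if $l:\mathbf{if}\,b\,\mathbf{then}\,g\in P$, then $\langle l,\sigma\rangle\rightarrow\langle g,\sigma\rangle$ when $\langle b,\sigma\rangle\rightarrow\mathbf{true}$ and $\langle l,\sigma\rangle\rightarrow\langle\mathbf{next}(l),\sigma\rangle$ when $\langle b,\sigma\rangle\rightarrow\mathbf{false}$; if $l:\mathbf{goto}\,g\in P$, then $\langle l,\sigma\rangle\rightarrow\langle g,\sigma\rangle$; if $l:\mathbf{skip}\in P$, or $l:\mathbf{halt}\in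 P$ and $\mathbf{next}(l):\mathbf{done}\in P$, then $\langle l,\sigma\rangle\rightarrow\langle\mathbf{next}(l),\sigma\rangle$. Live-variables augmented semantics. The prophecy variable is a set $\pi\subseteq V$. Evaluation $\langle e,\sigma,\pi\rangle\Rightarrow n$, $\langle b,\sigma,\pi\rangle\Rightarrow t$ is defined by the same rules with $\pi$ carried along, except that the variable rule is: $\langle v,\sigma,\pi\rangle\Rightarrow\sigma(v)$ if $v\in\mathrm{dom}\,\sigma$ and $v\in\pi$. The relation $\langle l,\sigma,\pi\rangle\Rightarrow\langle l',\sigma',\pi'\rangle$ is the least relation with: if $l:v:=e\in P$, $\langle e,\sigma,\pi\rangle\Rightarrow n$ and $\pi'\subseteq\pi\cup\{v\}$, then $\langle l,\sigma,\pi\rangle\Rightarrow\langle\mathbf{next}(l),\sigma[v\mapsto n],\pi'\rangle$; if $l:\mathbf{if}\,b\,\mathbf{then}\,g\in P$ and $\pi'\subseteq\pi$, then $\langle l,\sigma,\pi\rangle\Rightarrow\langle g,\sigma,\pi'\rangle$ when $\langle b,\sigma,\pi\rangle\Rightarrow\mathbf{true}$ and $\langle l,\sigma,\pi\rangle\Rightarrow\langle\mathbf{next}(l),\sigma,\pi'\rangle$ when $\langle b,\sigma,\pi\rangle\Rightarrow\mathbf{false}$; for $\mathbf{goto}$, $\mathbf{skip}$, $\mathbf{halt}$ the rules are the standard ones with $\pi'=\pi$. Live variables analysis. $\beta_{\bullet l},\beta_{l\bullet}\subseteq V$, for $l$ ranging over the labels of $P$, are the least solution (componentwise under $\subseteq$)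 of the equations: $\beta_{l\bullet}=\emptyset$ if $l:\mathbf{halt}\in P$; $\beta_{l\bullet}=\bigcup_{g\in\mathbf{succ}(l)}\beta_{\bullet g}$; $\beta_{\bullet l}=f(l,\beta_{l\bullet})$, where $f(l,\beta)=(\beta\setminus\{v\})\cup\mathbf{vars}(e)$ if $l:v:=e\in P$, $f(l,\beta)=\beta\cup\mathbf{vars}(b)$ if $l:\mathbf{if}\,b\,\mathbf{then}\,g\in P$, and $f(l,\beta)=\beta$ otherwise. (The two equations for $\mathbf{halt}$ labels are consistent, since $\mathbf{succ}$ of a $\mathbf{done}$ label is empty.) *)

(* Defs.v *)
From Stdlib Require List.
From mathcomp Require Import all_boot all_order all_algebra.
From mathcomp Require Import boolp classical_sets.
Set Implicit Arguments.
Unset Strict Implicit.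
Unset Printing Implicit Defensive.
Local Open Scope classical_set_scope.

Inductive aexp (V : Type) : Type :=
| AConst (n : int)
| AVar (v : V)
| AAdd (e0 e1 : aexp V)
| ASub (e0 e1 : aexp V)
| AMul (e0 e1 : aexp V).
Arguments AConst {V} n.

Inductive bexp (V : Type) : Type :=
| BTrue
| BFalse
| BEq (e0 e1 : aexp V)
| BLe (e0 e1 : aexp V)
| BNot (b : bexp V)
| BAnd (b0 b1 : bexp V)
| BOr (b0 b1 : bexp V).
Arguments BTrue {V}.
Arguments BFalse {V}.

Inductive cmd (V L : Type) : Type :=
| CSkip
| CAssign (v : V) (e : aexp V)
| CIf (b : bexp V) (g : L)
| CGoto (g : L)
| CHalt
| CDone.
Arguments CSkip {V L}.
Arguments CAssign {V L} v e.
Arguments CIf {V L} b g.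
Arguments CGoto {V L} g.
Arguments CHalt {V L}.
Arguments CDone {V L}.

Fixpoint avars (V : Type) (e : aexp V) : set V :=
  match e with
  | AConst _ => set0
  | AVar v => [set v]
  | AAdd e0 e1 | ASub e0 e1 | AMul e0 e1 => avars e0 `|` avars e1
  end.

Fixpoint bvars (V : Type) (b : bexp V) : set V :=
  match b with
  | BTrue | BFalse => set0
  | BEq e0 e1 | BLe e0 e1 => avars e0 `|` avars e1
  | BNot b => bvars b
  | BAnd b0 b1 | BOr b0 b1 => bvars b0 `|` bvars b1
  end.

(* [eqType] is no restriction on the sets of variables and labels: classically
   every type is an [eqType] (see [gen_eqMixin] in boolp). *)

Definition labels (V : Type) (L : eqType) (s : seq (L * cmd V L)) : seq L :=
  map fst s.

(* [cmd_in s l c] is "l : c \in s"; [List.In] because [cmd] carries no [eqType]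
   structure. *)
Definition cmd_in (V : Type) (L : eqType) (s : seq (L * cmd V L))
  (l : L) (c : cmd V L) : Prop := List.In (l, c) s.

(* [None] when [l] is the last label of [s] or is not a label of [s]. *)
Definition next_label (V : Type) (L : eqType) (s : seq (L * cmd V L)) (l : L) :
  option L := onth (labels s) (index l (labels s)).+1.

Definition needs_next (V L : Type) (c : cmd V L) : bool :=
  match c with
  | CSkip | CAssign _ _ | CIf _ _ | CHalt => true
  | CGoto _ | CDone => false
  end.

Definition branch_target (V L : Type) (c : cmd V L) : option L :=
  match c with
  | CIf _ g | CGoto g => Some g
  | CSkip | CAssign _ _ | CHalt | CDone => None
  end.

Record program (V : Type) (L : eqType) : Type := Program {
  prog_seq :> seq (L * cmd V L);
  _ : uniq (labels prog_seq);
  _ : forall l, cmd_in prog_seq l CHalt ->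
      exists2 l', next_label prog_seq l = Some l' & cmd_in prog_seq l' CDone;
  _ : forall l c g, cmd_in prog_seq l c -> branch_target c = Some g ->
      g \in labels prog_seq;
  _ : forall l c, cmd_in prog_seq l c -> needs_next c ->
      exists2 l', next_label prog_seq l = Some l' & l' \in labels prog_seq
}.

(* [succ P l c] is succ(l) when [cmd_in P l c]. *)
Definition succ (V : Type) (L : eqType) (P : program V L) (l : L)
  (c : cmd V L) : set L :=
  match c with
  | CAssign _ _ | CSkip | CHalt => [set l' | next_label P l = Some l']
  | CGoto g => [set g]
  | CIf _ g => [set l' | next_label P l = Some l'] `|` [set g]
  | CDone => set0
  end.

Definition state (V : Type) : Type := V -> option int.

Definition update (V : eqType) (sigma : state V) (v : V) (n : int) : state V :=
  fun x => if x == v then Some n else sigma x.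

Inductive aeval (V : Type) (sigma : state V) : aexp V -> int -> Prop :=
| AE_const n : aeval sigma (AConst n) n
| AE_var v n : sigma v = Some n -> aeval sigma (AVar v) n
| AE_add e0 e1 n0 n1 : aeval sigma e0 n0 -> aeval sigma e1 n1 ->
    aeval sigma (AAdd e0 e1) (n0 + n1)%R
| AE_sub e0 e1 n0 n1 : aeval sigma e0 n0 -> aeval sigma e1 n1 ->
    aeval sigma (ASub e0 e1) (n0 - n1)%R
| AE_mul e0 e1 n0 n1 : aeval sigma e0 n0 -> aeval sigma e1 n1 ->
    aeval sigma (AMul e0 e1) (n0 * n1)%R.

Inductive beval (V : Type) (sigma : state V) : bexp V -> bool -> Prop :=
| BE_true : beval sigma BTrue true
| BE_false : beval sigma BFalse false
| BE_eq e0 e1 n0 n1 : aeval sigma e0 n0 -> aeval sigma e1 n1 ->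
    beval sigma (BEq e0 e1) (n0 == n1)
| BE_le e0 e1 n0 n1 : aeval sigma e0 n0 -> aeval sigma e1 n1 ->
    beval sigma (BLe e0 e1) (n0 <= n1)%R
| BE_not b t : beval sigma b t -> beval sigma (BNot b) (~~ t)
| BE_and b0 b1 t0 t1 : beval sigma b0 t0 -> beval sigma b1 t1 ->
    beval sigma (BAnd b0 b1) (t0 && t1)
| BE_or b0 b1 t0 t1 : beval sigma b0 t0 -> beval sigma b1 t1 ->
    beval sigma (BOr b0 b1) (t0 || t1).

Inductive step (V L : eqType) (P : program V L) :
  L -> state V -> L -> state V -> Prop :=
| S_assign l l' v e n sigma :
    cmd_in P l (CAssign v e) -> aeval sigma e n -> next_label P l = Some l' ->
    step P l sigma l' (update sigma v n)
| S_if_true l b g sigma :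
    cmd_in P l (CIf b g) -> beval sigma b true ->
    step P l sigma g sigma
| S_if_false l l' b g sigma :
    cmd_in P l (CIf b g) -> beval sigma b false -> next_label P l = Some l' ->
    step P l sigma l' sigma
| S_goto l g sigma :
    cmd_in P l (CGoto g) ->
    step P l sigma g sigma
| S_skip l l' sigma :
    cmd_in P l CSkip -> next_label P l = Some l' ->
    step P l sigma l' sigma
| S_halt l l' sigma :
    cmd_in P l CHalt -> next_label P l = Some l' -> cmd_in P l' CDone ->
    step P l sigma l' sigma.

Inductive lv_aeval (V : Type) (sigma : state V) (pi : set V) :
  aexp V -> int -> Prop :=
| LAE_const n : lv_aeval sigma pi (AConst n) n
| LAE_var v n : sigma v = Some n -> pi v -> lv_aeval sigma pi (AVar v) n
| LAE_add e0 e1 n0 n1 : lv_aeval sigma pi e0 n0 -> lv_aeval sigma pi e1 n1 ->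
    lv_aeval sigma pi (AAdd e0 e1) (n0 + n1)%R
| LAE_sub e0 e1 n0 n1 : lv_aeval sigma pi e0 n0 -> lv_aeval sigma pi e1 n1 ->
    lv_aeval sigma pi (ASub e0 e1) (n0 - n1)%R
| LAE_mul e0 e1 n0 n1 : lv_aeval sigma pi e0 n0 -> lv_aeval sigma pi e1 n1 ->
    lv_aeval sigma pi (AMul e0 e1) (n0 * n1)%R.

Inductive lv_beval (V : Type) (sigma : state V) (pi : set V) :
  bexp V -> bool -> Prop :=
| LBE_true : lv_beval sigma pi BTrue true
| LBE_false : lv_beval sigma pi BFalse false
| LBE_eq e0 e1 n0 n1 : lv_aeval sigma pi e0 n0 -> lv_aeval sigma pi e1 n1 ->
    lv_beval sigma pi (BEq e0 e1) (n0 == n1)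
| LBE_le e0 e1 n0 n1 : lv_aeval sigma pi e0 n0 -> lv_aeval sigma pi e1 n1 ->
    lv_beval sigma pi (BLe e0 e1) (n0 <= n1)%R
| LBE_not b t : lv_beval sigma pi b t -> lv_beval sigma pi (BNot b) (~~ t)
| LBE_and b0 b1 t0 t1 : lv_beval sigma pi b0 t0 -> lv_beval sigma pi b1 t1 ->
    lv_beval sigma pi (BAnd b0 b1) (t0 && t1)
| LBE_or b0 b1 t0 t1 : lv_beval sigma pi b0 t0 -> lv_beval sigma pi b1 t1 ->
    lv_beval sigma pi (BOr b0 b1) (t0 || t1).

Inductive lv_step (V L : eqType) (P : program V L) :
  L -> state V -> set V -> L -> state V -> set V -> Prop :=
| LS_assign l l' v e n sigma (pi pi' : set V) :
    cmd_in P l (CAssign v e) -> lv_aeval sigma pi e n ->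
    pi' `<=` pi `|` [set v] -> next_label P l = Some l' ->
    lv_step P l sigma pi l' (update sigma v n) pi'
| LS_if_true l b g sigma (pi pi' : set V) :
    cmd_in P l (CIf b g) -> pi' `<=` pi -> lv_beval sigma pi b true ->
    lv_step P l sigma pi g sigma pi'
| LS_if_false l l' b g sigma (pi pi' : set V) :
    cmd_in P l (CIf b g) -> pi' `<=` pi -> lv_beval sigma pi b false ->
    next_label P l = Some l' ->
    lv_step P l sigma pi l' sigma pi'
| LS_goto l g sigma pi :
    cmd_in P l (CGoto g) ->
    lv_step P l sigma pi g sigma pi
| LS_skip l l' sigma pi :
    cmd_in P l CSkip -> next_label P l = Some l' ->
    lv_step P l sigma pi l' sigma pi
| LS_halt l l' sigma pi :
    cmd_in P l CHalt -> next_label P l = Some l' -> cmd_in P l' CDone ->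
    lv_step P l sigma pi l' sigma pi.

(* [lv_transfer c] is f(l, _) when [cmd_in P l c]. *)
Definition lv_transfer (V L : Type) (c : cmd V L) (beta : set V) : set V :=
  match c with
  | CAssign v e => (beta `\ v) `|` avars e
  | CIf b _ => beta `|` bvars b
  | CSkip | CGoto _ | CHalt | CDone => beta
  end.

(* [pre l] and [post l] stand for beta_{.l} and beta_{l.}; their values outside
   the labels of [P] are irrelevant. *)
Definition lv_solution (V : Type) (L : eqType) (P : program V L)
  (pre post : L -> set V) : Prop :=
  forall l c, cmd_in P l c ->
    [/\ c = CHalt -> post l = set0,
        post l = \bigcup_(g in succ P l c) pre g
      & pre l = lv_transfer c (post l)].

Definition lv_analysis (V : Type) (L : eqType) (P : program V L)
  (pre post : L -> set V) : Prop :=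
  lv_solution P pre post /\
  forall pre' post' : L -> set V, lv_solution P pre' post' ->
    forall l, l \in labels P -> pre l `<=` pre' l /\ post l `<=` post' l.

(* Main.v *)
(* Every variable a command reads is live before it, so the augmented evaluation
   reproduces the standard one. The equations give pre l' <= post l along each
   edge, and post l is contained in pre l, up to the assigned variable. The rules
   with a single successor and no prophecy update need pre l = pre l', which
   holds because the union over successors is then a singleton union. *)
Require Import Defs.
From mathcomp Require Import all_boot all_order all_algebra.
From mathcomp Require Import boolp classical_sets.

(** Only the variable rule consults [pi], and an inclusion of a union in [pi] splits into one
    inclusion per operand. *)
Lemma lv_aeval_of_aeval (V : Type) (sigma : state V) (pi : set V) (e : aexp V)
  (n : int) :
  aeval sigma e n -> (avars e `<=` pi)%classic -> lv_aeval sigma pi e n.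
Proof.
elim=> [m|v m hv|e0 e1 n0 n1 _ IH0 _ IH1|e0 e1 n0 n1 _ IH0 _ IH1
       |e0 e1 n0 n1 _ IH0 _ IH1] /=.
- by constructor.
- by move=> hpi; constructor=> //; apply: hpi.
- by rewrite subUset => -[h0 h1]; constructor; [apply: IH0|apply: IH1].
- by rewrite subUset => -[h0 h1]; constructor; [apply: IH0|apply: IH1].
- by rewrite subUset => -[h0 h1]; constructor; [apply: IH0|apply: IH1].
Qed.

Lemma lv_beval_of_beval (V : Type) (sigma : state V) (pi : set V) (b : bexp V)
  (t : bool) :
  beval sigma b t -> (bvars b `<=` pi)%classic -> lv_beval sigma pi b t.
Proof.
elim=> [||e0 e1 n0 n1 ev0 ev1|e0 e1 n0 n1 ev0 ev1|b0 t0 _ IH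
       |b0 b1 t0 t1 _ IH0 _ IH1|b0 b1 t0 t1 _ IH0 _ IH1] /=.
- by constructor.
- by constructor.
- by rewrite subUset => -[h0 h1]; constructor; apply: lv_aeval_of_aeval.
- by rewrite subUset => -[h0 h1]; constructor; apply: lv_aeval_of_aeval.
- by move=> h; constructor; apply: IH.
- by rewrite subUset => -[h0 h1]; constructor; [apply: IH0|apply: IH1].
- by rewrite subUset => -[h0 h1]; constructor; [apply: IH0|apply: IH1].
Qed.

Lemma lv_pre {V : Type} {L : eqType} {P : program V L} {pre post : L -> set V}
  (hsol : lv_solution P pre post) {l : L} {c : cmd V L} :
  cmd_in P l c -> pre l = lv_transfer c (post l).
Proof. by move=> /hsol[]. Qed.

(** An inclusion only, since at a conditional [post l] joins two successors and may exceed either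
    one. *)
Lemma lv_pre_succ_sub {V : Type} {L : eqType} {P : program V L}
  {pre post : L -> set V} (hsol : lv_solution P pre post) {l l' : L}
  {c : cmd V L} :
  cmd_in P l c -> succ P l c l' -> (pre l' `<=` post l)%classic.
Proof. by move=> /hsol[_ -> _] hl'; apply: bigcup_sup. Qed.

Lemma lv_post_succ1 {V : Type} {L : eqType} {P : program V L}
  {pre post : L -> set V} (hsol : lv_solution P pre post) {l l' : L}
  {c : cmd V L} :
  cmd_in P l c -> succ P l c = [set l']%classic -> post l = pre l'.
Proof. by move=> /hsol[_ -> _] ->; rewrite bigcup_set1. Qed.

(** Puts [succ] of a skip or halt command into the singleton form that [lv_post_succ1] expects. *)
Lemma next_label_set1 {V : Type} {L : eqType} {P : program V L} {l l' : L} :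
  next_label P l = Some l' ->
  [set g | next_label P l = Some g]%classic = [set l']%classic.
Proof. by move=> ->; apply/seteqP; split=> g /= => [[]|->]. Qed.

Theorem theorem4p9 (V L : eqType) (P : program V L) (pre post : L -> set V)
  (hlv : lv_analysis P pre post) (l l' : L) (sigma sigma' : state V) :
  step P l sigma l' sigma' ->
  lv_step P l sigma (pre l) l' sigma' (pre l').
Proof.
case: hlv => hsol _.
case=> {l l' sigma sigma'}.
- move=> l l' v e n sigma hc he hn.
  apply: (LS_assign hc _ _ hn).
    by apply: lv_aeval_of_aeval he _; rewrite (lv_pre hsol hc); apply: subsetUr.
  (* By conversion, [hn] is itself the membership of [l'] in [succ P l (CAssign v e)]. *)
  rewrite (lv_pre hsol hc) /= => x /(lv_pre_succ_sub hsol hc hn) hx.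
  (* The assigned variable is allowed by the extra [[set v]]; any other one survives the removal of
     [v] from [post l]. *)
  by have [->|/eqP xv] := eqVneq x v; [right|left; left].
- move=> l b g sigma hc hb.
  apply: (LS_if_true hc _ _); rewrite (lv_pre hsol hc) /=.
    (* The transfer of a test only adds variables, so [pre g] lies in [post l] and hence in [pre l];
       [right] selects the branch target. *)
    by apply: subset_trans (@subsetUl _ _ _);
      apply: (lv_pre_succ_sub hsol hc); right.
  by apply: lv_beval_of_beval hb _; apply: subsetUr.
- move=> l l' b g sigma hc hb hn.
  apply: (LS_if_false hc _ _ hn); rewrite (lv_pre hsol hc) /=.
    by apply: subset_trans (@subsetUl _ _ _);
      apply: (lv_pre_succ_sub hsol hc); left.
  by apply: lv_beval_of_beval hb _; apply: subsetUr.
- move=> l g sigma hc.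
  (* [erefl] suffices because [succ] of a goto is a singleton by definition. *)
  by rewrite (lv_pre hsol hc) /= (lv_post_succ1 hsol hc erefl); apply: LS_goto.
- move=> l l' sigma hc hn.
  rewrite (lv_pre hsol hc) /= (lv_post_succ1 hsol hc (next_label_set1 hn)).
  exact: LS_skip.
- move=> l l' sigma hc hn hd.
  rewrite (lv_pre hsol hc) /= (lv_post_succ1 hsol hc (next_label_set1 hn)).
  exact: LS_halt.
Qed.
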